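(* One of the following statements holds: (i) $\alpha$ is of class $C^{1+\epsilon}$; (ii) $\alpha$ is nowhere differentiable.
   Context: Identify $\mathbb{S}^1$ with $\mathbb{R}/\mathbb{Z}$ via $t\mapsto(\cos 2\pi t,\sin 2\pi t)$; functions on $\mathbb{S}^1$ are identified with $1$-periodic functions on $\mathbb{R}$. Fix $\epsilon\in(0,1)$; $C^{k+\epsilon}$ means $C^k$ with $\epsilon$-Hölder $k$-th derivative. Let $f:\mathbb{S}^1\to\mathbb{S}^1$ be a $C^{2+\epsilon}$ expanding map, i.e. there is $\lambda>1$ with $|Df(x)|>\lambda$ for every $x$, and let $v:\mathbb{S}^1\to\mathbb{R}$ be a $C^{1+\epsilon}$ function. The generalized Weierstrass function $\alpha:\mathbb{S}^1\to\mathbb{R}$ is $$\alpha(y)=-\sum_{n=1}^{\infty}\frac{v(f^{n-1}(y))}{Df^n(y)},$$ where $f^n$ is the $n$-th iterate of $f$; it is the unique bounded solution of $v(x)=\alpha(f(x))-Df(x)\alpha(x)$. *)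

(* Defs.v *)
From HB Require Import structures.
From mathcomp Require Import all_boot all_order all_algebra.
From mathcomp Require Import generic_quotient.
From mathcomp Require Import all_classical all_reals all_analysis.
Set Implicit Arguments.
Unset Strict Implicit.
Unset Printing Implicit Defensive.
Import Order.TTheory GRing.Theory Num.Theory.
Import numFieldNormedType.Exports.
Local Open Scope classical_set_scope.
Local Open Scope ring_scope.
Local Open Scope quotient_scope.

Section Circle.
Variable R : realType.

Definition eqmodZ (x y : R) : bool := x - y \is a Num.int.

Lemma eqmodZ_refl : reflexive eqmodZ.
Proof. by move=> x; rewrite /eqmodZ subrr rpred0. Qed.

Lemma eqmodZ_sym : symmetric eqmodZ.
Proof. by move=> x y; rewrite /eqmodZ -rpredN opprB. Qed.

Lemma eqmodZ_trans : transitive eqmodZ.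
Proof.
by move=> y x z xy yz; rewrite /eqmodZ -(subrKA y) rpredD.
Qed.

Canonical eqmodZ_equiv := EquivRel eqmodZ eqmodZ_refl eqmodZ_sym eqmodZ_trans.

Definition circle : Type := {eq_quot eqmodZ_equiv}.

Definition proj (t : R) : circle := \pi_({eq_quot eqmodZ_equiv}) t.

Definition rep (x : circle) : R := repr (x : {eq_quot eqmodZ_equiv}).

Lemma repK (x : circle) : proj (rep x) = x.
Proof. exact: reprK. Qed.

Lemma proj_eqP (s t : R) : reflect (proj s = proj t) (s - t \is a Num.int).
Proof. exact: (@eqquotP _ eqmodZ_equiv {eq_quot eqmodZ_equiv} s t). Qed.

(* g is C^k on the line with globally eps-Hoelder k-th derivative; continuity
   of the k-th derivative follows from the Hoelder bound when 0 < eps. For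
   periodic k-th derivatives the global bound amounts to the Hoelder condition
   on the circle. *)
Definition holder_class (k : nat) (eps : R) (g : R -> R) : Prop :=
  (forall j, (j < k)%N -> forall x, derivable (derive1n j g) x 1) /\
  exists C : R, forall x y, `|derive1n k g x - derive1n k g y| <= C * `|x - y| `^ eps.

Definition fun_class (k : nat) (eps : R) (u : circle -> R) : Prop :=
  holder_class k eps (u \o proj).

Definition differentiable_on_circle_at (u : circle -> R) (x : circle) : Prop :=
  derivable (u \o proj) (rep x) 1.

Definition nowhere_differentiable (u : circle -> R) : Prop :=
  forall x, ~ differentiable_on_circle_at u x.

Definition is_lift (F : R -> R) (f : circle -> circle) : Prop :=
  forall t, proj (F t) = f (proj t).

Definition map_class (k : nat) (eps : R) (f : circle -> circle) : Prop :=
  exists F, is_lift F f /\ holder_class k eps F.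

(* Continuous lifts of the same map differ by a constant integer, so the choice
   made here does not affect the derivative; see Dcircle_lift below. *)
Definition lift_of (f : circle -> circle) : R -> R :=
  xget (idfun : R -> R) [set F : R -> R | continuous F /\ is_lift F f].

Definition Dcircle (f : circle -> circle) (x : circle) : R :=
  derive1 (lift_of f) (rep x).

Definition expanding (f : circle -> circle) : Prop :=
  exists2 lambda : R, 1 < lambda & forall x, lambda < `|Dcircle f x|.

(* The index is shifted: the term of index n below is the (n+1)-st term of the
   series defining the generalized Weierstrass function. *)
Definition weierstrass (f : circle -> circle) (v : circle -> R)
    (y : circle) : R :=
  - limn [series v (iter n f y) / Dcircle (iter n.+1 f) y]_n.

End Circle.

Lemma continuous_int_cst (R : realType) (h : R -> R) :
  continuous h -> (forall t, h t \is a Num.int) -> forall s t, h s = h t.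
Proof.
move=> hc hi.
suff H : forall s t, s <= t -> h s = h t.
  by move=> s t; case: (leP s t) => [|/ltW] /H.
move=> s t st; apply/eqP; apply/negP => /negP hst.
have n01 m : ~ (0 < (m%:~R : R) < 1).
  by rewrite ltr0z ltrz1 => /andP[]; case: m => [[|]|].
wlog lt : h hc hi hst / h s < h t.
  move=> W; case: (ltgtP (h s) (h t)) hst => // hlt _.
    by apply: (W h) => //; rewrite lt_eqF.
  apply: (W (fun x => - h x)).
  - by move=> x; apply: cvgN; exact: hc.
  - by move=> x; rewrite rpredN.
  - by rewrite eqr_opp gt_eqF.
  - by rewrite ltrN2.
have /intrP[a Ea] := hi s; have /intrP[b Eb] := hi t.
have ab : h s + 1 <= h t.
  move: lt; rewrite Ea Eb ltr_int -[X in _ + X]/(1%:~R) -intrD ler_int.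
  by rewrite lezD1.
have [c _ Ec] : exists2 c, c \in `[s, t] & h c = h s + 2^-1.
  apply: IVT => //; first exact: continuous_subspaceT.
  have h2 : (2^-1 : R) <= 1 by rewrite invf_le1 // ler1n.
  rewrite min_l ?(ltW lt)// max_r ?(ltW lt)//.
  by rewrite lerDl invr_ge0 ler0n /= (le_trans _ ab)// lerD2l.
have /intrP[m Em] := hi c.
apply: (n01 (m - a)).
rewrite intrB -Em -Ea Ec addrAC subrr add0r invr_gt0 ltr0n /=.
by rewrite invf_lt1 // ltr1n.
Qed.

Lemma Dcircle_lift (R : realType) (f : circle R -> circle R) (F : R -> R) :
  continuous F -> is_lift F f -> forall t, Dcircle f (proj t) = derive1 F t.
Proof.
move=> cF lF t.
have [cG lG] : continuous (lift_of f) /\ is_lift (lift_of f) f.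
  by apply: (@xgetPex _ _ [set F : R -> R | continuous F /\ is_lift F f]); exists F.
rewrite /Dcircle; set G := lift_of f in cG lG *; set s := rep _.
pose k := s - t.
have kint : k \is a Num.int by apply/proj_eqP; rewrite repK.
pose h x := G (x + k) - F x.
have hint x : h x \is a Num.int.
  apply/proj_eqP; rewrite lG lF; congr f; apply/proj_eqP.
  by rewrite addrAC subrr add0r.
have hc : continuous h.
  move=> x; apply: cvgB; last exact: cF.
  apply: (@continuous_comp _ _ _ (fun y => y + k) G); last exact: cG.
  by apply: cvgD; [exact: cvg_id | exact: cvg_cst].
have hcst := continuous_int_cst hc hint.
have GE x : G (x + k) = F x + h t by rewrite (hcst t x) /h [RHS]addrC subrK.
rewrite /derive1; apply: (congr1 (fun u => lim (u @ 0^'))); apply/funext => e /=.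
have -> : s = t + k by rewrite /k [RHS]addrC subrK.
by rewrite addrA !GE opprD addrACA subrr addr0.
Qed.

(* Main.v *)
Require Import Defs.
From mathcomp Require Import all_boot all_order all_algebra.
From mathcomp Require Import all_classical all_reals all_analysis.
From mathcomp Require Import ring lra.
Set Implicit Arguments.
Unset Strict Implicit.
Unset Printing Implicit Defensive.
Import Order.TTheory GRing.Theory Num.Theory.
Import numFieldNormedType.Exports.
Local Open Scope classical_set_scope.
Local Open Scope ring_scope.

(** The map [f] lifts to a diffeomorphism [F] of the line with |F'| >= lam > 1,
and [A], the lift of the Weierstrass function, is a bounded 1-periodic solution
of the twisted equation  A (F t) = V t + F' t * A t.  The claim is that a
derivative [a] of [A] at a single point [x] forces [A] to be C^{1+eps}
everywhere, because expansion blows up the neighbourhoods of [x] to unit size.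

Start with the tangent line of [A] at [x] and push it forward through the
twisted equation: [push h] is the function on which the equation takes the value
dictated by [h] one step before, so that [A] is a fixed point of [push].  Let
[renorm n] be the n-th image of the tangent line and I_n the interval of radius
2 around F^n x.  Two estimates hold on I_n.

- [A - renorm n] at F^n t is (F^n)' t times the error of the tangent line at [t]
  ([renorm_error]).  That error is o(|t - x|), while bounded distortion
  ([bounded_distortion]) bounds (F^n)' t * |t - x| by a constant as long as
  F^n t stays in I_n.  Hence [renorm n] tends to [A] uniformly on I_n
  ([renorm_cvg]).

- In the recursion for the derivative of [renorm n], the multiplier F' of the
  twisted equation cancels against the derivative of F^-1, which leaves
    k_(n+1) = (V'/F' + F''/F' * h_n + k_n) o F^-1,   k_n = h_n'.
  Composition with F^-1 shrinks the eps-Hoelder constant of k_n by lam^-eps.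
  The Hoelder constant of h_n is controlled at a small scale by the sup norm of
  h_n and a small multiple of the Hoelder constant of k_n
  ([norm_bound_of_holder_derivative]), so the Hoelder constants of the k_n stay
  bounded ([drenorm_holder]).

Since [A] is 1-periodic and I_n is longer than a period, [A] is on every small
window a uniform limit of functions with uniformly Hoelder derivatives.  Such a
limit is C^{1+eps} ([holder_class1_of_uniform_limit]): its difference quotients
over a window of size w differ by at most a constant times w^eps, a property
that passes to uniform limits and implies the claim
([holder_class1_of_secants]). *)

(** * Calculus on the line *)

Lemma powR_small (R : realType) (p e : R) : 0 < p -> 0 < e ->
  exists2 w : R, 0 < w <= 1 & w `^ p <= e.
Proof.
move=> p0 e0; have ep := powR_gt0 p^-1 e0.
exists (Num.min 1 (e `^ p^-1)).
  by rewrite lt_min ltr01 ep ge_min lexx.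
have eE : (e `^ p^-1) `^ p = e by rewrite -powRrM mulVf ?gt_eqF// powRr1 ?ltW.
rewrite -[leRHS]eE.
apply: ge0_ler_powR; rewrite ?nnegrE ?le_min ?ler01 ?ge_min ?lexx ?orbT//;
  exact: ltW.
Qed.

(** The definition of the derivative with the quotient cleared, which also
makes sense at the point itself. *)
Lemma is_derive_le_dist (R : realType) (g : R -> R) (x a : R) :
  is_derive x 1 g a -> forall e : R, 0 < e ->
  exists2 r : R, 0 < r &
    forall t, `|t - x| < r -> `|g t - g x - a * (t - x)| <= e * `|t - x|.
Proof.
move=> [dg ga] e e0.
have : h^-1 *: (g (h *: 1 + x) - g x) @[h --> 0^'] --> a by rewrite -ga.
move=> /cvgrPdist_le /(_ _ e0)[r /= r0 Hr].
exists r => // t tr; have [->|tx] := eqVneq t x.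
  by rewrite !subrr mulr0 subr0 normr0 mulr0.
have tx0 : t - x != 0 by rewrite subr_eq0.
have := Hr (t - x); rewrite /ball /= sub0r normrN => /(_ tr tx0).
rewrite [_%:A]mulr1 subrK => H.
have -> : g t - g x - a * (t - x) =
    - (a - (t - x)^-1 *: (g t - g x)) * (t - x).
  by rewrite /GRing.scale /=; field.
by rewrite normrM normrN ler_wpM2r.
Qed.

Lemma is_derive_continuous (R : realType) (g dg : R -> R) :
  (forall z : R, is_derive z 1 g (dg z)) -> continuous g.
Proof.
move=> gd z; have [gdz _] := gd z.
exact/differentiable_continuous/derivable1_diffP.
Qed.

(** The mean value theorem without an assumption on the order of the endpoints. *)
Lemma MVT_min_max (R : realType) (g dg : R -> R) :
  (forall z : R, is_derive z 1 g (dg z)) -> forall s t, exists c : R,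
  Num.min s t <= c <= Num.max s t /\ g t - g s = dg c * (t - s).
Proof.
move=> gd; have gc := is_derive_continuous gd.
have W : forall s t, s <= t -> exists c : R,
    s <= c <= t /\ g t - g s = dg c * (t - s).
  move=> s t st.
  have [|c] := @MVT_segment _ g dg _ _ st (fun z _ => gd z).
  - exact: continuous_subspaceT.
  - by rewrite in_itv /= => cst E; exists c.
move=> s t; have [st|/ltW ts] := leP s t; first exact: W.
have [c [cst E]] := W _ _ ts; exists c; split=> //.
by rewrite -opprB E -mulrN opprB.
Qed.

Lemma min_max_dist (R : realType) (p w a b c : R) : `|a - p| <= w -> `|b - p| <= w ->
  Num.min a b <= c <= Num.max a b -> `|c - p| <= w.
Proof.
by rewrite !ler_distl ge_min le_max => /andP[? ?] /andP[? ?] /andP[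
  /orP[?|?] /orP[?|?]]; apply/andP; split; lra.
Qed.

Lemma is_derive_lipschitz (R : realType) (g dg : R -> R) (M : R) :
  (forall z : R, is_derive z 1 g (dg z)) -> (forall z, `|dg z| <= M) ->
  forall s t, `|g s - g t| <= M * `|s - t|.
Proof.
move=> gd gM s t; have [c [_ ->]] := MVT_min_max gd t s.
by rewrite normrM ler_wpM2r.
Qed.

Lemma periodic_int (R : realType) (g : R -> R) : (forall t, g (t + 1) = g t) ->
  forall (m : int) t, g (t + m%:~R) = g t.
Proof.
move=> gp m; elim/int_rec: m => [t|n IH t|n IH t]; first by rewrite addr0.
- by rewrite -addn1 PoszD intrD addrA gp.
- by rewrite -[LHS]gp -addn1 PoszD opprD intrD addrA mulrN1z subrK.
Qed.

Lemma holder_constant_ge0 (R : realType) (g : R -> R) (C eps : R) :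
  (forall s t, `|g s - g t| <= C * `|s - t| `^ eps) -> 0 <= C.
Proof.
by move=> /(_ 1 0); rewrite subr0 normr1 powR1 mulr1; apply: le_trans.
Qed.

Lemma periodic_bounded (R : realType) (g : R -> R) (C eps : R) : 0 <= eps ->
  (forall t, g (t + 1) = g t) ->
  (forall s t, `|g s - g t| <= C * `|s - t| `^ eps) ->
  exists M : R, forall t, `|g t| <= M.
Proof.
move=> e0 gp gC; have C0 := holder_constant_ge0 gC; exists (C + `|g 0|) => t.
rewrite -(periodic_int gp (- Num.floor t)) intrN.
rewrite -[X in `|X|](subrK (g 0)) (le_trans (ler_normD _ _))// lerD2r.
rewrite (le_trans (gC _ _))// subr0 -[leRHS]mulr1 ler_wpM2l//.
have ft : 0 <= t - (Num.floor t)%:~R by rewrite subr_ge0 floor_le.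
rewrite ger0_norm//; apply: (@le_trans _ _ (1 `^ eps)); last by rewrite powR1.
rewrite ge0_ler_powR ?nnegrE//.
by have := floorD1_gt t; rewrite intrD => /ltW; rewrite lerBlDl.
Qed.

(** * A secant criterion for C^{1+eps} *)

Definition secant (R : realType) (g : R -> R) (a b : R) : R :=
  (g b - g a) / (b - a).

(** Hypothesis [gH] is the trace that a derivative with Hoelder constant [H]
leaves on difference quotients; unlike a bound on the derivative, it survives
uniform limits. *)
Section SecantCriterion.
Variables (R : realType) (g : R -> R) (H delta M eps : R).
Hypotheses (eps0 : 0 < eps) (delta0 : 0 < delta).
Hypothesis gM : forall s, `|g s| <= M.
Hypothesis gH : forall p w a b c d : R, 0 < w <= delta ->
  `|a - p| <= w -> `|b - p| <= w -> `|c - p| <= w -> `|d - p| <= w ->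
  a != b -> c != d -> `|secant g a b - secant g c d| <= H * w `^ eps.

Let H0 : 0 <= H.
Proof.
have d0 : `|0 - 0 : R| <= delta by rewrite subrr normr0 ltW.
have d1 : `|delta - 0| <= delta by rewrite subr0 gtr0_norm.
have := @gH 0 delta 0 delta 0 delta; rewrite delta0 lexx /= => /(_ isT d0 d1 d0 d1).
rewrite eq_sym gt_eqF// subrr normr0 => /(_ isT isT).
by rewrite pmulr_lge0 // powR_gt0.
Qed.

Let secant_small (e : R) : 0 < e -> exists2 w : R, 0 < w <= delta & H * w `^ eps < e.
Proof.
move=> e0; have H1 : 0 < H + 1 by rewrite ltr_wpDl.
have [w /andP[w0 _] wH] := powR_small eps0 (divr_gt0 e0 H1).
exists (Num.min w delta); first by rewrite lt_min w0 delta0 ge_min lexx orbT.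
have : Num.min w delta `^ eps <= e / (H + 1).
  apply: le_trans wH; apply: ge0_ler_powR;
    rewrite ?nnegrE ?le_min ?ge_min ?lexx ?(ltW w0) ?(ltW delta0) ?(ltW eps0)//.
rewrite ler_pdivlMr// mulrDr mulr1 mulrC => h.
apply: lt_le_trans h; rewrite ltrDl powR_gt0//.
by rewrite lt_min w0.
Qed.

Let derivable_of_secants (s : R) : derivable g s 1.
Proof.
apply: R_complete; apply: cauchy_exP => e e0.
have [w /andP[w0 wd] wH] := secant_small e0.
exists (secant g s (s + w)); exists w => //= h; rewrite /ball /= sub0r normrN.
move=> hw h0; apply: le_lt_trans wH.
have -> : h^-1 *: (g (h *: 1 + s) - g s) = secant g s (h + s).
  by rewrite /secant [_%:A]mulr1 addrK /GRing.scale /= mulrC.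
apply: (@gH s); rewrite ?w0 ?wd ?subrr ?normr0 ?(ltW w0) ?addrK ?(ltW hw)//.
- by rewrite addrAC subrr add0r ger0_norm// ltW.
- by rewrite -subr_eq0 opprD addrA subrr sub0r oppr_eq0 gt_eqF.
- by rewrite -subr_eq0 opprD addrCA subrr addr0 oppr_eq0.
Qed.

Let dg : R -> R := derive1 g.

Let gd (s : R) : is_derive s 1 g (dg s).
Proof. by rewrite /dg derive1E; apply/derivableP/derivable_of_secants. Qed.

(** The derivative at any point of a window is a limit of secants of that
window. *)
Let derive_near_secant (s w a b : R) : 0 < w <= delta ->
  `|a - s| <= w -> `|b - s| <= w -> a != b ->
  `|dg s - secant g a b| <= H * w `^ eps.
Proof.
move=> /[dup] wd /andP[w0 _] aw bw ab; apply/ler_addgt0Pr => e e0.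
have [r r0 Hr] := is_derive_le_dist (gd s) e0.
pose h := Num.min w (r / 2); have h0 : 0 < h by rewrite lt_min w0 divr_gt0.
have hN : `|s + h - s| = h by rewrite addrAC subrr add0r gtr0_norm.
have sh : s != s + h by rewrite -subr_eq0 opprD addrA subrr sub0r oppr_eq0 gt_eqF.
have dsec : `|dg s - secant g s (s + h)| <= e.
  have := Hr (s + h); rewrite hN gt_min; have -> : r / 2 < r by lra.
  rewrite orbT => /(_ isT).
  have -> : g (s + h) - g s - dg s * (s + h - s) =
      - (dg s - secant g s (s + h)) * h.
    rewrite /secant; have -> : s + h - s = h by lra.
    by field; rewrite gt_eqF.
  by rewrite normrM normrN (gtr0_norm h0) ler_pM2r.
rewrite -(subrKA (secant g s (s + h))) (le_trans (ler_normD _ _))// addrC lerD//.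
by apply: (@gH s); rewrite ?wd ?subrr ?normr0 ?(ltW w0) ?hN// ge_min lexx.
Qed.

(** For close points, both derivatives are compared with the secant that joins
the two points; for distant points, it suffices that the derivative is
bounded, which follows from comparing it with a secant of length [delta]. *)
Lemma holder_class1_of_secants : holder_class 1 eps g.
Proof.
split=> [[|j]//|].
rewrite derive1n1 -/dg.
pose K := 2 * M / delta + H * delta `^ eps.
have M0 : 0 <= M by exact: le_trans (gM 0).
have de0 := powR_gt0 eps delta0.
have K0 : 0 <= K by rewrite addr_ge0 ?mulr_ge0 ?invr_ge0 ?(ltW delta0) ?(ltW de0).
have dgK s : `|dg s| <= K.
  have d0 : `|s + delta - s| = delta by rewrite addrAC subrr add0r gtr0_norm.
  have := @derive_near_secant s delta s (s + delta).
  rewrite delta0 lexx subrr normr0 (ltW delta0) d0 lexx => /(_ isT isT isT).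
  rewrite -subr_eq0 opprD addrA subrr sub0r oppr_eq0 gt_eqF// => /(_ isT) h.
  rewrite -(subrK (secant g s (s + delta)) (dg s)) (le_trans (ler_normD _ _))//.
  rewrite /K addrC lerD// /secant normrM normfV d0 ler_pM2r ?invr_gt0//.
  rewrite (le_trans (ler_normB _ _))//.
  by have := gM s; have := gM (s + delta); lra.
exists (2 * H + 2 * K / delta `^ eps) => s t.
have st0 : 0 <= `|s - t| `^ eps by exact: powR_ge0.
rewrite mulrDl; have [le|lt] := leP `|s - t| delta.
  apply: (@le_trans _ _ (2 * H * `|s - t| `^ eps)); last first.
    by rewrite lerDl mulr_ge0// divr_ge0 ?mulr_ge0// ltW.
  have [->|st] := eqVneq s t.
    by rewrite !subrr normr0 powR0 ?mulr0 ?gt_eqF.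
  have w0 : 0 < `|s - t| <= delta by rewrite normr_gt0 subr_eq0 st.
  have zw (x : R) : `|x - x| <= `|s - t| by rewrite subrr normr0.
  have ts : `|t - s| <= `|s - t| by rewrite distrC.
  have hs := derive_near_secant w0 (zw s) ts st.
  have ht := derive_near_secant w0 (lexx _) (zw t) st.
  rewrite -(subrKA (secant g s t)) (le_trans (ler_normD _ _))//.
  by rewrite -mulrA mulr2n mulrDl mul1r lerD// distrC.
apply: (@le_trans _ _ (2 * K)).
  by rewrite (le_trans (ler_normB _ _))//; have := dgK s; have := dgK t; lra.
apply: ler_wpDl; first by rewrite mulr_ge0// mulr_ge0.
rewrite -mulrA ler_peMr ?mulr_ge0// mulrC ler_pdivlMr// mul1r.
by apply: ge0_ler_powR; rewrite ?nnegrE ?(ltW delta0) ?(ltW eps0) ?(ltW lt).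
Qed.

End SecantCriterion.

(** Only one centre [y] is available for each precision, possibly a different one
each time; periodicity makes the interval of radius 2 around it reach every
point of the line, so no convergence of the centres is needed. *)
Section UniformLimit.
Variables (R : realType) (g : R -> R) (H delta M eps : R).
Hypotheses (eps0 : 0 < eps) (H0 : 0 <= H) (delta01 : 0 < delta <= 1).
Hypothesis gp : forall t, g (t + 1) = g t.
Hypothesis gM : forall s, `|g s| <= M.
Hypothesis approx : forall e : R, 0 < e -> exists y : R, exists h k : R -> R,
  [/\ forall z : R, is_derive z 1 h (k z),
      forall s, `|s - y| <= 2 -> `|g s - h s| <= e &
      forall s t, `|s - y| <= 2 -> `|t - y| <= 2 -> `|s - t| <= delta ->
        `|k s - k t| <= H * `|s - t| `^ eps].

Lemma secant_sub_le (h : R -> R) (a b e : R) : a != b ->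
  `|g a - h a| <= e -> `|g b - h b| <= e ->
  `|secant g a b - secant h a b| <= 2 * e / `|b - a|.
Proof.
move=> ab ha hb; rewrite /secant -mulrBl normrM normfV.
rewrite ler_pM2r; last by rewrite invr_gt0 normr_gt0 subr_eq0 eq_sym.
have -> : g b - g a - (h b - h a) = (g b - h b) - (g a - h a) by ring.
by rewrite (le_trans (ler_normB _ _))//; lra.
Qed.

Lemma holder_class1_of_uniform_limit : holder_class 1 eps g.
Proof.
have [delta0 delta1] := andP delta01.
apply: (@holder_class1_of_secants _ _ (H * 2 `^ eps) (delta / 2) M) => //.
  by rewrite divr_gt0.
move=> p w a b c d /andP[w0 wd] ap bp cp dp ab cd.
have ba0 : 0 < `|b - a| by rewrite normr_gt0 subr_eq0 eq_sym.
have dc0 : 0 < `|d - c| by rewrite normr_gt0 subr_eq0 eq_sym.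
pose B := 2 / `|b - a| + 2 / `|d - c|.
have B0 : 0 < B by rewrite addr_gt0 ?divr_gt0.
apply/ler_addgt0Pr => e e0.
have [y [h [k [hk gh kH]]]] := approx (divr_gt0 e0 B0).
(* Translating the window by an integer brings it within reach of y. *)
pose m := (Num.floor (y - p))%:~R : R.
have pm : `|p + m - y| <= 1.
  have := floor_le (y - p); have := floorD1_gt (y - p).
  by rewrite intrD -/m ler_distl => *; lra.
have shift_secant s t : secant g s t = secant g (s + m) (t + m).
  by rewrite /secant !(periodic_int gp) opprD addrACA subrr addr0.
have near s : `|s - p| <= w -> `|s + m - (p + m)| <= w.
  by rewrite opprD addrACA subrr addr0.
have near2 s : `|s - (p + m)| <= w -> `|s - y| <= 2.
  move=> sw; rewrite -(subrKA (p + m)) (le_trans (ler_normD _ _))//; lra.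
have mvt s t : s != t -> `|s - p| <= w -> `|t - p| <= w -> exists2 z : R,
    `|z - (p + m)| <= w & secant h (s + m) (t + m) = k z.
  move=> st sw tw; have [z [zst E]] := MVT_min_max hk (s + m) (t + m).
  exists z; first by apply: min_max_dist zst; exact: near.
  rewrite /secant E; field; rewrite opprD addrACA subrr addr0.
  by rewrite subr_eq0 eq_sym.
have close s t : s != t -> `|s - p| <= w -> `|t - p| <= w ->
    `|secant g s t - secant h (s + m) (t + m)| <= 2 * (e / B) / `|t - s|.
  move=> st sw tw; rewrite shift_secant.
  have -> : t - s = t + m - (s + m) by ring.
  by apply: secant_sub_le; rewrite ?(inj_eq (addIr m))//; apply/gh/near2/near.
have [z zw zE] := mvt _ _ ab ap bp; have [z' zw' zE'] := mvt _ _ cd cp dp.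
have zz : `|z - z'| <= 2 * w.
  by rewrite -(subrKA (p + m)) (le_trans (ler_normD _ _))// (distrC _ z'); lra.
have := close _ _ ab ap bp; have := close _ _ cd cp dp; rewrite zE zE' => hcd hab.
have kz : `|k z - k z'| <= H * `|z - z'| `^ eps.
  by apply: kH; rewrite ?near2//; lra.
have zzw : H * `|z - z'| `^ eps <= H * 2 `^ eps * w `^ eps.
  rewrite -mulrA -powRM ?(ltW w0)// ler_wpM2l// ge0_ler_powR ?nnegrE ?(ltW eps0)//.
  by rewrite mulr_ge0 ?(ltW w0).
have -> : secant g a b - secant g c d =
  (k z - k z') + ((secant g a b - k z) - (secant g c d - k z')) by ring.
rewrite (le_trans (ler_normD _ _))// lerD ?(le_trans kz)//.
rewrite (le_trans (ler_normB _ _))// (le_trans (lerD hab hcd))//.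
have -> : 2 * (e / B) / `|b - a| + 2 * (e / B) / `|d - c| = e / B * B.
  by rewrite /B; ring.
by rewrite divfK ?gt_eqF.
Qed.

End UniformLimit.

(** * Expanding maps of the line *)

Section ExpandingLineMap.
Variables (R : realType) (F F1 F2 : R -> R) (lam C : R).
Hypothesis lam1 : 1 < lam.
Hypothesis Fd : forall z : R, is_derive z 1 F (F1 z).
Hypothesis F1d : forall z : R, is_derive z 1 F1 (F2 z).
Hypothesis F1_ge : forall z, lam <= `|F1 z|.
Hypothesis F2_le : forall z, `|F2 z| <= C.

Let lam0 : 0 < lam. Proof. exact: lt_trans lam1. Qed.
Let C0 : 0 <= C. Proof. exact: le_trans (F2_le 0). Qed.

Lemma expanding_derivative_neq0 z : F1 z != 0.
Proof. by rewrite -normr_gt0 (lt_le_trans lam0). Qed.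

Lemma expanding_dist s t : lam * `|s - t| <= `|F s - F t|.
Proof. by have [c [_ ->]] := MVT_min_max Fd t s; rewrite normrM ler_wpM2r. Qed.

Lemma expanding_dist_iter n s t :
  lam ^+ n * `|s - t| <= `|iter n F s - iter n F t|.
Proof.
elim: n => [|n IH]; first by rewrite mul1r.
rewrite exprS -mulrA !iterS (le_trans _ (expanding_dist _ _))//.
by rewrite ler_wpM2l// ltW.
Qed.

Lemma expanding_injective : injective F.
Proof.
move=> s t st; have := expanding_dist s t; rewrite st subrr normr0 pmulr_rle0//.
by rewrite normr_le0 subr_eq0 => /eqP.
Qed.

(** A derivative bounded away from 0 keeps its sign, so [F] is monotone and
moves at least at unit speed in both directions. *)
Lemma expanding_surjective y : exists t, F t = y.
Proof.
have Fc := is_derive_continuous Fd; have F1c := is_derive_continuous F1d.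
pose N := `|y - F 0|; have N0 : 0 <= N by exact: normr_ge0.
have NN : - N <= N by lra.
have [c [_ Ec]] := MVT_min_max Fd 0 N; have [c' [_ Ec']] := MVT_min_max Fd 0 (- N).
(* The derivative keeps a constant sign, so that F N and F (- N) lie on either
   side of F 0, at distance at least N from it. *)
have same_sign : 0 < F1 c * F1 c'.
  rewrite lt_neqAle eq_sym mulf_neq0 ?expanding_derivative_neq0//=.
  rewrite leNgt; apply/negP => neg.
  have W s t : s <= t -> F1 s * F1 t < 0 -> False.
    move=> st ST; have [||z _ /eqP] := @IVT _ F1 s t 0 st.
    - exact: continuous_subspaceT.
    - by rewrite ge_min le_max; nra.
    - by rewrite (negbTE (expanding_derivative_neq0 z)).
  by have [/W|/ltW/W] := leP c c'; apply; rewrite // mulrC.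
have [||t _ Et] := @IVT _ F (- N) N y NN; last by exists t.
  exact: continuous_subspaceT.
have Fge z : 1 <= `|F1 z| by rewrite (le_trans _ (F1_ge z))// ltW.
have := Fge c; have := Fge c'; have : `|y - F 0| <= N by [].
rewrite subr0 in Ec; rewrite subr0 mulrN in Ec'.
rewrite ler_norml ge_min le_max => /andP[y1 y2].
case: (ler0P (F1 c)) => c0; case: (ler0P (F1 c')) => c'0 h' h.
- have : N <= - F1 c * N by rewrite ler_peMl.
  have : N <= - F1 c' * N by rewrite ler_peMl.
  by move=> *; apply/andP; split; apply/orP; [right|left]; lra.
- by nra.
- by nra.
- have : N <= F1 c * N by rewrite ler_peMl.
  have : N <= F1 c' * N by rewrite ler_peMl.
  by move=> *; apply/andP; split; apply/orP; [left|right]; lra.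
Qed.

Lemma expanding_inverse : exists G, cancel F G /\ cancel G F.
Proof.
have [G GK] := choice expanding_surjective.
by exists G; split=> // t; apply: expanding_injective; rewrite GK.
Qed.

Definition iter_derivative n t := \prod_(i < n) F1 (iter i F t).

Lemma iter_derivativeS n t :
  iter_derivative n.+1 t = iter_derivative n t * F1 (iter n F t).
Proof. by rewrite /iter_derivative big_ord_recr. Qed.

(** By induction on [n]: one more step multiplies the left-hand side by
|F' p|, where p = F^n s and q = F^n t, and the right-hand factor |p - q| by
|F' c| for some c between them; the ratio of the two is at most
exp (C |p - q|).  As |p - q| <= |F p - F q| / lam, the exponents add up to a
geometric series, whence the constant C / (lam - 1), the solution of
C + B = B * lam. *)
Lemma bounded_distortion n s t :
  `|iter_derivative n s| * `|s - t| <=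
  `|iter n F s - iter n F t| *
    expR (C / (lam - 1) * `|iter n F s - iter n F t|).
Proof.
have B0 : 0 <= C / (lam - 1) by rewrite divr_ge0// subr_ge0 ltW.
elim: n => [|n IH].
  rewrite /iter_derivative big_ord0 normr1 mul1r ler_peMr//.
  by rewrite (le_trans _ (expR_ge1Dx _))// lerDl mulr_ge0.
rewrite iter_derivativeS !iterS normrM.
set p := iter n F s in IH *; set q := iter n F t in IH *.
rewrite mulrAC (le_trans (ler_wpM2r _ IH))//.
have [c [cpq E]] := MVT_min_max Fd q p.
have F1_lip : `|F1 p| <= `|F1 c| * expR (C * `|p - q|).
  have pc : `|p - c| <= `|p - q|.
    rewrite distrC; apply: min_max_dist cpq; last by rewrite subrr normr0.
    by rewrite distrC.
  have lip := le_trans (is_derive_lipschitz F1d F2_le p c) (ler_wpM2l C0 pc).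
  have c1 : 1 <= `|F1 c| by rewrite (le_trans _ (F1_ge c))// ltW.
  have e1 := expR_ge1Dx (C * `|p - q|).
  have Cpq : 0 <= C * `|p - q| by rewrite mulr_ge0.
  have := le_trans (lerB_dist (F1 p) (F1 c)) lip; rewrite lerBlDr addrC => h.
  apply: (le_trans h); apply: (@le_trans _ _ (`|F1 c| * (1 + C * `|p - q|))).
    by rewrite mulrDr mulr1 lerD2l ler_peMl.
  by rewrite ler_wpM2l.
have FE : `|F p - F q| = `|F1 c| * `|p - q| by rewrite E normrM.
have expand := expanding_dist p q.
apply: (@le_trans _ _ (`|F p - F q| *
    (expR (C * `|p - q|) * expR (C / (lam - 1) * `|p - q|)))).
  rewrite mulrC mulrA [leRHS]mulrA ler_wpM2r ?expR_ge0//.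
  by rewrite FE mulrAC ler_wpM2r.
rewrite ler_wpM2l// -expRD ler_expR -mulrDl.
have -> : C + C / (lam - 1) = C / (lam - 1) * lam.
  by field; rewrite subr_eq0 gt_eqF.
by rewrite -mulrA ler_wpM2l.
Qed.

End ExpandingLineMap.

(** * Renormalization at a point of differentiability *)

(** The derivative equals, at some point of an interval of length [delta], a
difference quotient bounded by 2 M / delta; the Hoelder bound then transports
this to the endpoint.  What matters below is that the coefficient of [H] is
small when [delta] is. *)
Lemma norm_bound_of_holder_derivative (R : realType)
    (h k : R -> R) (y M H delta eps : R) :
  0 < eps -> 0 < delta <= 1 -> 0 <= H ->
  (forall z : R, is_derive z 1 h (k z)) ->
  (forall s, `|s - y| <= 2 -> `|h s| <= M) ->
  (forall s t, `|s - y| <= 2 -> `|t - y| <= 2 -> `|s - t| <= delta ->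
     `|k s - k t| <= H * `|s - t| `^ eps) ->
  forall s, `|s - y| <= 2 -> `|k s| <= 2 * M / delta + H * delta `^ eps.
Proof.
move=> eps0 /andP[d0 d1] H0 hk hM kH s sy.
have [t ty tE] : exists2 t, `|t - y| <= 2 & `|t - s| = delta.
  move: sy; rewrite ler_distl; case: (leP s y) => sy' /andP[? ?].
    exists (s + delta); first by rewrite ler_distl; apply/andP; split; lra.
    by rewrite addrAC subrr add0r gtr0_norm.
  exists (s - delta); first by rewrite ler_distl; apply/andP; split; lra.
  by rewrite addrAC subrr add0r normrN gtr0_norm.
have [c [cst E]] := MVT_min_max hk s t.
have cs : `|c - s| <= delta.
  apply: min_max_dist cst; first by rewrite subrr normr0 ltW.
  by rewrite tE.
have cy : `|c - y| <= 2 by exact: min_max_dist cst.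
have kc : `|k c| <= 2 * M / delta.
  rewrite ler_pdivlMr// -tE -normrM -E (le_trans (ler_normB _ _))//.
  by have := hM _ sy; have := hM _ ty; lra.
rewrite -(subrK (k c) (k s)) (le_trans (ler_normD _ _))// addrC lerD//.
rewrite (le_trans (kH _ _ _ _ _))// distrC// ler_wpM2l//.
by rewrite ge0_ler_powR ?nnegrE ?(ltW d0) ?(ltW eps0).
Qed.

Lemma quotient_holder (R : realType) (N D : R -> R) (MN CN CD eps : R) :
  0 < eps < 1 -> 0 <= CD ->
  (forall s, `|N s| <= MN) -> (forall s, 1 <= `|D s|) ->
  (forall s t, `|N s - N t| <= CN * `|s - t| `^ eps) ->
  (forall s t, `|D s - D t| <= CD * `|s - t|) ->
  forall s t, `|s - t| <= 1 ->
  `|N s / D s - N t / D t| <= (CN + MN * CD) * `|s - t| `^ eps.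
Proof.
move=> /andP[eps0 eps1] CD0 NM D1 NH DL s t st.
have D0 z : D z != 0 by rewrite -normr_gt0 (lt_le_trans ltr01).
have MN0 : 0 <= MN by exact: le_trans (NM 0).
have De z u : `|u / D z| <= `|u|.
  by rewrite normrM normfV ler_piMr// invf_le1 ?normr_gt0.
have -> : N s / D s - N t / D t = (N s - N t) / D s - N t * (D s - D t) / D t / D s.
  by field; rewrite !D0.
rewrite (le_trans (ler_normB _ _))// [leRHS]mulrDl lerD//.
  exact: le_trans (De _ _) (NH s t).
do 2 apply: (le_trans (De _ _)).
rewrite normrM -mulrA ler_pM// (le_trans (DL s t))// ler_wpM2l//.
have [->|sNt] := eqVneq s t; first by rewrite subrr normr0 powR_ge0.
by rewrite ger1_powR ?normr_gt0 ?subr_eq0 ?sNt ?st// ltW.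
Qed.

Section Renormalization.
Variables (R : realType) (F F1 F2 V V1 A : R -> R).
Variables (lam C CF MV CV M eps x a : R).
Hypotheses (eps01 : 0 < eps < 1) (lam1 : 1 < lam).
Hypothesis Fd : forall z : R, is_derive z 1 F (F1 z).
Hypothesis F1d : forall z : R, is_derive z 1 F1 (F2 z).
Hypothesis F1_ge : forall z, lam <= `|F1 z|.
Hypothesis F2_le : forall z, `|F2 z| <= C.
Hypothesis F2_holder : forall s t, `|F2 s - F2 t| <= CF * `|s - t| `^ eps.
Hypothesis Vd : forall z : R, is_derive z 1 V (V1 z).
Hypothesis V1_le : forall z, `|V1 z| <= MV.
Hypothesis V1_holder : forall s t, `|V1 s - V1 t| <= CV * `|s - t| `^ eps.
Hypothesis AM : forall s, `|A s| <= M.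
Hypothesis AF : forall t, A (F t) = V t + F1 t * A t.
Hypothesis Ad : is_derive x 1 A a.
Variable G : R -> R.
Hypotheses (FK : cancel F G) (GK : cancel G F).

Let lam0 : 0 < lam. Proof. exact: lt_trans lam1. Qed.
Let C0 : 0 <= C. Proof. exact: le_trans (F2_le 0). Qed.
Let F1_neq0 z : F1 z != 0. Proof. exact: (expanding_derivative_neq0 lam1 F1_ge). Qed.

(** The twisted equation for [A] says that [A] is fixed by [push]; [dpush]
computes the derivative of [push h] from [h] and its derivative [k]. *)
Definition push (h : R -> R) s := V (G s) + F1 (G s) * h (G s).
Definition dpush (h k : R -> R) s :=
  V1 (G s) / F1 (G s) + F2 (G s) / F1 (G s) * h (G s) + k (G s).

Definition tangent s := A x + a * (s - x).
Definition renorm n := iter n push tangent.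
Fixpoint drenorm n : R -> R :=
  if n is n'.+1 then dpush (renorm n') (drenorm n') else cst a.

Lemma inverse_is_derive (s : R) : is_derive s 1 G (F1 (G s))^-1.
Proof.
rewrite -{1}(GK s); apply: is_derive_inverse (Fd _) _ => //.
- by apply: filterE => z; exact: FK.
- by apply: filterE => z; exact: (is_derive_continuous Fd).
Qed.

Lemma renorm_is_derive n (s : R) : is_derive s 1 (renorm n) (drenorm n s).
Proof.
elim: n s => [|n IH] s.
  have -> : renorm 0 = cst (A x - a * x) + a *: (id : R -> R).
    apply/funext => t; rewrite /renorm/= /tangent !fctE/=.
    by rewrite mulrBr addrCA addrC.
  have := is_deriveD (is_derive_cst (A x - a * x) s (1 : R))
    (is_deriveZ a (is_derive_id s (1 : R))).
  by rewrite add0r /GRing.scale /= mulr1.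
have Gd := inverse_is_derive s.
have VG := is_derive1_comp (Vd (G s)) Gd.
have FG := is_derive1_comp (F1d (G s)) Gd.
have hG := is_derive1_comp (IH (G s)) Gd.
apply: (is_derive_eq (is_deriveD VG (is_deriveM FG hG))).
rewrite /= /dpush /GRing.scale /=; field.
exact: F1_neq0.
Qed.

Lemma inverse_dist s t : lam * `|G s - G t| <= `|s - t|.
Proof. by have := expanding_dist Fd F1_ge (G s) (G t); rewrite !GK. Qed.

(** Each step multiplies the difference of two functions by F', since the term
[V] of the twisted equation cancels. *)
Lemma renorm_error n t :
  A (iter n F t) - renorm n (iter n F t) =
  iter_derivative F F1 n t * (A t - tangent t).
Proof.
elim: n => [|n IH]; first by rewrite /iter_derivative big_ord0 mul1r.
rewrite iter_derivativeS iterS mulrAC -IH AF.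
have -> : renorm n.+1 (F (iter n F t)) =
    V (iter n F t) + F1 (iter n F t) * renorm n (iter n F t).
  by rewrite /renorm iterS /push FK.
ring.
Qed.

Let B := C / (lam - 1).

(** The factor 2 * expR (B * 2) is the distortion bound on an interval of
radius 2. *)
Lemma renorm_error_le n s e :
  (forall t, `|t - x| <= 2 / lam ^+ n -> `|A t - tangent t| <= e * `|t - x|) ->
  0 <= e -> `|s - iter n F x| <= 2 ->
  `|A s - renorm n s| <= e * (2 * expR (B * 2)).
Proof.
move=> he e0 sx; have B0 : 0 <= B by rewrite divr_ge0// subr_ge0 ltW.
pose t := iter n G s; have sE : s = iter n F t.
  by rewrite /t; elim: (n) => // m IH; rewrite iterSr iterS GK.
rewrite sE renorm_error normrM; rewrite {}sE in sx.
have tx : `|t - x| <= 2 / lam ^+ n.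
  rewrite ler_pdivlMr ?exprn_gt0// mulrC.
  exact: le_trans (expanding_dist_iter lam1 Fd F1_ge _ _ _) sx.
rewrite (le_trans (ler_wpM2l _ (he _ tx)))// mulrCA ler_wpM2l//.
rewrite (le_trans (bounded_distortion lam1 Fd F1d F1_ge F2_le _ _ _))//.
by rewrite ler_pM ?expR_ge0// ler_expR ler_wpM2l.
Qed.

(** Differentiability bounds the error near [x], boundedness of [A] away from
[x]. *)
Lemma tangent_le : exists2 K : R, 0 <= K &
  forall t, `|A t - tangent t| <= K * `|t - x|.
Proof.
have [r r0 Hr] := is_derive_le_dist Ad ltr01.
have M0 : 0 <= M by exact: le_trans (AM 0).
have K0 : 0 <= 2 * M / r by rewrite divr_ge0 ?mulr_ge0// ltW.
exists (1 + 2 * M / r + `|a|); first by rewrite !addr_ge0.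
move=> t; rewrite /tangent opprD addrA.
have [lt|ge] := ltP `|t - x| r.
  by rewrite (le_trans (Hr _ lt))// ler_wpM2r// -addrA lerDl addr_ge0.
rewrite (le_trans (ler_normB _ _))// normrM mulrDl lerD2r.
rewrite (le_trans (ler_normB _ _))// mulrDl.
have : 2 * M <= 2 * M / r * `|t - x|.
  by rewrite -mulrA ler_peMr ?mulr_ge0// mulrC ler_pdivlMr// mul1r.
by have := AM t; have := AM x; have := normr_ge0 (t - x); lra.
Qed.

Lemma renorm_cvg e : 0 < e -> exists n, forall s,
  `|s - iter n F x| <= 2 -> `|A s - renorm n s| <= e.
Proof.
move=> e0; have Z0 : 0 < 2 * expR (B * 2) by rewrite mulr_gt0// expR_gt0.
have e'0 := divr_gt0 e0 Z0.
have [r r0 Hr] := is_derive_le_dist Ad e'0.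
have [n nr] : exists n, 2 / lam ^+ n < r.
  have : lam^-1 ^+ n @[n --> \oo] --> 0.
    by apply: cvg_expr; rewrite gtr0_norm ?invr_gt0// invf_lt1.
  move=> /cvgrPdist_lt /(_ (r / 2)) [|N _ HN]; first by rewrite divr_gt0.
  exists N; have := HN N (leqnn N); rewrite sub0r normrN.
  rewrite ger0_norm ?exprn_ge0 ?invr_ge0 ?ltW// exprVn.
  by rewrite ltr_pdivlMr// mulrC.
exists n => s sx; rewrite -(divfK (lt0r_neq0 Z0) e).
apply: renorm_error_le => [t tx| |//]; last exact: ltW.
by rewrite /tangent opprD addrA Hr// (le_lt_trans tx).
Qed.

(** [renorm n] stays within a bounded distance of [A], although its multiplier
exceeds 1 at every step. *)
Lemma renorm_bounded : exists2 M' : R, 0 <= M' & forall n s,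
  `|s - iter n F x| <= 2 -> `|renorm n s| <= M'.
Proof.
have [K K0 HK] := tangent_le; have M0 : 0 <= M by exact: le_trans (AM 0).
exists (M + K * (2 * expR (B * 2))).
  by rewrite addr_ge0// !mulr_ge0// expR_ge0.
move=> n s sx; have := @renorm_error_le n s K (fun t _ => HK t) K0 sx.
rewrite -(subKr (A s) (renorm n s)) => h.
by rewrite (le_trans (ler_normB _ _))// lerD//; rewrite subKr in h.
Qed.

(** Writing L = lam^eps > 1, one step turns the Hoelder constant [H] at scale
[delta] into at most (E + C * H * delta^eps + H) / L, where [E] does not depend
on [H].  The scale is chosen so that C * delta^eps <= (L - 1) / 2, which makes
the map of constants a contraction, and H = 2 E / (L - 1) is then preserved. *)
Lemma drenorm_holder : exists H delta : R, [/\ 0 <= H, 0 < delta <= 1 &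
  forall n s t, `|s - iter n F x| <= 2 -> `|t - iter n F x| <= 2 ->
    `|s - t| <= delta ->
    `|drenorm n s - drenorm n t| <= H * `|s - t| `^ eps].
Proof.
have [eps0 eps1] := andP eps01.
have CF0 := holder_constant_ge0 F2_holder; have CV0 := holder_constant_ge0 V1_holder.
have MV0 : 0 <= MV by exact: le_trans (V1_le 0).
have [M' M'0 renormM] := renorm_bounded.
pose L := lam `^ eps; have L1 : 1 < L.
  by rewrite /L -(powRr0 lam) /powR gt_eqF// ltr_expR ltr_pM2r ?ln_gt0.
have Lpos : 0 < L by exact: lt_trans L1.
have C1 : 0 < C + 1 by rewrite ltr_wpDl.
have [delta d01 dE] : exists2 d : R, 0 < d <= 1 & C * d `^ eps <= (L - 1) / 2.
  have [|d d01 dE] := @powR_small R eps ((L - 1) / 2 / (C + 1)) eps0.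
    by rewrite !divr_gt0// subr_gt0.
  exists d => //; move: dE; rewrite ler_pdivlMr// => dE.
  by apply: le_trans dE; rewrite mulrC ler_wpM2l ?powR_ge0// lerDl.
have [d0 d1] := andP d01.
pose Q := CV + MV * C; pose S := CF + C * C.
pose E := Q + S * M' + C * (2 * M' / delta).
have E0 : 0 <= E by rewrite /E /Q /S !(addr_ge0, mulr_ge0, invr_ge0)// ltW.
pose H := 2 * E / (L - 1).
have H0 : 0 <= H by rewrite divr_ge0 ?mulr_ge0// subr_ge0 ltW.
have EH : E + C * (H * delta `^ eps) + H <= H * L.
  have -> : E = H * ((L - 1) / 2) by rewrite /H; field; rewrite subr_eq0 gt_eqF.
  by rewrite mulrCA; have := ler_wpM2l H0 dE; lra.
exists H, delta; split=> //; elim=> [|n IH] s t sx tx st.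
  by rewrite /= subrr normr0 mulr_ge0// powR_ge0.
have Gst := inverse_dist s t.
have GF u : `|u - iter n.+1 F x| <= 2 -> `|G u - iter n F x| <= 2.
  move=> ux; have := inverse_dist u (iter n.+1 F x); rewrite iterS FK => h.
  have : `|G u - iter n F x| <= lam * `|G u - iter n F x|.
    by rewrite ler_peMl// ltW.
  by rewrite -iterS in h; lra.
have {sx}sx := GF _ sx; have {tx}tx := GF _ tx.
rewrite /= /dpush; set p := G s in Gst sx *; set q := G t in Gst tx *.
have pq_st : `|p - q| <= `|s - t| by rewrite (le_trans _ Gst)// ler_peMl// ltW.
have pqd := le_trans pq_st st; have pq1 := le_trans pqd d1.
have F1_ge1 z : 1 <= `|F1 z| by rewrite (le_trans _ (F1_ge z))// ltW.
have F1_lip := is_derive_lipschitz F1d F2_le.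
have hV := quotient_holder eps01 C0 V1_le F1_ge1 V1_holder F1_lip pq1.
have hF := quotient_holder eps01 C0 F2_le F1_ge1 F2_holder F1_lip pq1.
rewrite -/Q in hV; rewrite -/S in hF.
have hk := IH _ _ sx tx pqd.
(* As |p - q| <= 1, a Lipschitz bound is also an eps-Hoelder bound. *)
have hh : `|renorm n p - renorm n q| <=
    (2 * M' / delta + H * delta `^ eps) * `|p - q| `^ eps.
  have [c [cpq ->]] := MVT_min_max (@renorm_is_derive n) q p.
  rewrite normrM ler_pM//.
    apply: (norm_bound_of_holder_derivative eps0 d01 H0 (@renorm_is_derive n)
      (@renormM n) IH).
    exact: min_max_dist cpq.
  have [->|pNq] := eqVneq p q; first by rewrite subrr normr0 powR_ge0.
  by rewrite ger1_powR ?normr_gt0 ?subr_eq0 ?pNq ?pq1// ltW.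
have F21 : `|F2 p / F1 p| <= C.
  rewrite normrM normfV (le_trans _ (F2_le p))// ler_piMr//.
  by rewrite invf_le1// (lt_le_trans ltr01).
set X := `|p - q| `^ eps in hV hF hk hh *.
have X0 : 0 <= X by exact: powR_ge0.
have XL : L * X <= `|s - t| `^ eps.
  rewrite -powRM ?(ltW lam0)//.
  by rewrite ge0_ler_powR ?nnegrE ?mulr_ge0 ?(ltW lam0) ?(ltW eps0).
have -> : V1 p / F1 p + F2 p / F1 p * renorm n p + drenorm n p -
    (V1 q / F1 q + F2 q / F1 q * renorm n q + drenorm n q) =
    (V1 p / F1 p - V1 q / F1 q) + (F2 p / F1 p - F2 q / F1 q) * renorm n q
    + F2 p / F1 p * (renorm n p - renorm n q) + (drenorm n p - drenorm n q).
  by ring.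
apply: (@le_trans _ _ (Q * X + S * X * M' +
    C * ((2 * M' / delta + H * delta `^ eps) * X) + H * X)).
  rewrite (le_trans (ler_normD _ _))// lerD//.
  rewrite (le_trans (ler_normD _ _))// lerD//; last by rewrite normrM ler_pM.
  rewrite (le_trans (ler_normD _ _))// lerD//.
  by rewrite normrM ler_pM// renormM.
apply: (@le_trans _ _ (H * (L * X))); last by rewrite ler_wpM2l.
apply: le_trans (_ : (E + C * (H * delta `^ eps) + H) * X <= _).
  by rewrite le_eqVlt; apply/orP; left; apply/eqP; rewrite /E; ring.
by rewrite [leRHS]mulrA ler_wpM2r.
Qed.

Hypothesis Ap : forall t, A (t + 1) = A t.

Lemma holder_class1_of_differentiable_at : holder_class 1 eps A.
Proof.
have [eps0 _] := andP eps01.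
have [H [delta [H0 d01 Hh]]] := drenorm_holder.
apply: (holder_class1_of_uniform_limit eps0 H0 d01 Ap AM) => e e0.
have [n hn] := renorm_cvg e0.
exists (iter n F x), (renorm n), (drenorm n); split=> //.
- exact: renorm_is_derive.
- exact: Hh.
Qed.

End Renormalization.

(** * The Weierstrass series on the line *)

Section CocycleSeries.
Variables (R : realType) (F F1 V : R -> R) (lam M : R).
Hypothesis lam1 : 1 < lam.
Hypothesis F1_ge : forall z, lam <= `|F1 z|.
Hypothesis VM : forall t, `|V t| <= M.

Let lam0 : 0 < lam. Proof. exact: lt_trans lam1. Qed.
Let M0 : 0 <= M. Proof. exact: le_trans (VM 0). Qed.
Let q01 : `|lam^-1| < 1.
Proof. by rewrite gtr0_norm ?invr_gt0// invf_lt1. Qed.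

Definition cocycle_term t n := V (iter n F t) / iter_derivative F F1 n.+1 t.

Lemma iter_derivativeSr n t :
  iter_derivative F F1 n.+1 t = F1 t * iter_derivative F F1 n (F t).
Proof.
rewrite /iter_derivative big_ord_recl; congr (_ * _).
by apply: eq_bigr => i _; rewrite /= -iterSr.
Qed.

Lemma iter_derivative_ge n t : lam ^+ n <= `|iter_derivative F F1 n t|.
Proof.
elim: n => [|n IH]; first by rewrite /iter_derivative big_ord0 normr1.
by rewrite iter_derivativeS normrM exprSr ler_pM// ?exprn_ge0 ?(ltW lam0).
Qed.

Lemma cocycle_term_le t n : `|cocycle_term t n| <= geometric (M / lam) lam^-1 n.
Proof.
have := iter_derivative_ge n.+1 t; have ln := exprn_gt0 n.+1 lam0 => h.
rewrite /cocycle_term /geometric /= normrM normfV -mulrA -exprS exprVn ler_pM//.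
by rewrite lef_pV2// posrE (lt_le_trans ln).
Qed.

Lemma normed_cocycle_series_is_cvg (t : R) : cvgn [normed series (cocycle_term t)].
Proof.
apply: series_le_cvg (cocycle_term_le t) _ => [n|n|].
- exact: normr_ge0.
- by rewrite geometric_ge0 ?divr_ge0 ?invr_ge0 ?(ltW lam0).
- exact: is_cvg_geometric_series.
Qed.

Lemma cocycle_series_is_cvg t : cvgn (series (cocycle_term t)).
Proof. exact/normed_cvg/normed_cocycle_series_is_cvg. Qed.

(** The Weierstrass function is the opposite of this sum. *)
Definition cocycle_sum t := limn (series (cocycle_term t)).

Lemma cocycle_sum_bounded : exists K : R, forall t, `|cocycle_sum t| <= K.
Proof.
exists (limn (series (geometric (M / lam) lam^-1))) => t.
have cn := @normed_cocycle_series_is_cvg t.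
apply: (le_trans (lim_series_norm cn)); apply: lim_series_le => [||n].
- exact: cn.
- exact: is_cvg_geometric_series.
- exact: cocycle_term_le.
Qed.

(** The twisted equation: the chain rule (F^(n+2))' t = F' t * (F^(n+1))' (F t)
makes the series at [t], without its first term, 1 / F' t times the series at
[F t]. *)
Lemma cocycle_sumE t : F1 t * cocycle_sum t = V t + cocycle_sum (F t).
Proof.
have F10 z : F1 z != 0 by rewrite -normr_gt0 (lt_le_trans lam0).
have E n : F1 t * series (cocycle_term t) n.+1 = V t + series (cocycle_term (F t)) n.
  rewrite /series /= big_nat_recl// mulrDr; congr (_ + _).
    by rewrite /cocycle_term iter_derivativeS /iter_derivative big_ord0 mul1r mulrC divfK.
  rewrite mulr_sumr; apply: eq_bigr => i _.
  rewrite /cocycle_term iterSr [in LHS]iter_derivativeSr invfM mulrCA.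
  by rewrite mulVKf.
have l1 : V t + series (cocycle_term (F t)) n @[n --> \oo] --> V t + cocycle_sum (F t).
  by apply: cvgD; [exact: cvg_cst|exact: cocycle_series_is_cvg].
have l2 : F1 t * series (cocycle_term t) n.+1 @[n --> \oo] --> F1 t * cocycle_sum t.
  apply: cvgM; first exact: cvg_cst.
  by rewrite cvg_shiftS; exact: cocycle_series_is_cvg.
apply: (cvg_unique _ l2) => //.
by have -> := funext E.
Qed.

Hypothesis Fd : forall z : R, is_derive z 1 F (F1 z).

Lemma iter_is_derive n (t : R) : is_derive t 1 (iter n F) (iter_derivative F F1 n t).
Proof.
elim: n => [|n IH]; first by rewrite /iter_derivative big_ord0; exact: is_derive_id.
rewrite iter_derivativeS mulrC.
exact: (is_derive1_comp (Fd (iter n F t)) IH).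
Qed.

End CocycleSeries.

(** * From the circle to the line *)

Lemma derive1_shift1 (R : realType) (g : R -> R) (c : R) :
  (forall t, g (t + 1) = g t + c) -> forall t, derive1 g (t + 1) = derive1 g t.
Proof.
move=> gc t; rewrite /derive1.
apply: (congr1 (fun u => lim (u @ 0^'))); apply/funext => h /=.
by rewrite addrA !gc opprD addrACA subrr addr0.
Qed.

Section CircleLift.
Variable R : realType.
Implicit Types (f : circle R -> circle R) (F : R -> R).

Lemma proj_add1 (t : R) : Defs.proj (t + 1) = Defs.proj t.
Proof. by apply/esym/proj_eqP; rewrite opprD addrA subrr sub0r rpredN rpred1. Qed.

Lemma proj_iter f F : is_lift F f ->
  forall n t, Defs.proj (iter n F t) = iter n f (Defs.proj t).
Proof. by move=> lF; elim=> //= n IH t; rewrite lF IH. Qed.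

(** The increment of a lift over a period is a continuous integer-valued
function. *)
Lemma lift_add1 f F : continuous F -> is_lift F f ->
  exists c : R, forall t, F (t + 1) = F t + c.
Proof.
move=> cF lF; exists (F 1 - F 0) => t.
have hint s : F (s + 1) - F s \is a Num.int.
  by apply/proj_eqP; rewrite !lF proj_add1.
have hc : continuous (fun s : R => F (s + 1) - F s).
  move=> s; apply: cvgB; last exact: cF.
  apply: (@continuous_comp _ _ _ (fun y : R => y + 1) F); last exact: cF.
  by apply: cvgD; [exact: cvg_id | exact: cvg_cst].
have := continuous_int_cst hc hint t 0; rewrite add0r => <-.
by rewrite addrCA subrr addr0.
Qed.

Lemma weierstrass_proj f F F1 (v : circle R -> R) : is_lift F f ->
  (forall z : R, is_derive z 1 F (F1 z)) ->
  forall t, weierstrass f v (Defs.proj t) = - cocycle_sum F F1 (v \o @Defs.proj R) t.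
Proof.
move=> lF Fd t; rewrite /weierstrass /cocycle_sum; congr (- limn (series _)).
apply/funext => n; rewrite /cocycle_term /= -(proj_iter lF).
have Fnd := iter_is_derive Fd n.+1.
rewrite (@Dcircle_lift _ _ (iter n.+1 F)).
- by rewrite derive1E derive_val.
- exact: is_derive_continuous Fnd.
- by move=> s; exact: proj_iter.
Qed.

End CircleLift.

Lemma holder_class_derivative (R : realType) k eps (g : R -> R) :
  holder_class k.+1 eps g -> holder_class k eps (derive1 g).
Proof.
move=> [gd gH]; split=> [j jk s|].
  by have := gd j.+1 jk s; rewrite /derive1n iterSr.
by move: gH; rewrite /derive1n iterSr.
Qed.

Lemma holder_class_is_derive (R : realType) k eps (g : R -> R) :
  holder_class k.+1 eps g -> forall z : R, is_derive z 1 g (derive1 g z).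
Proof.
by move=> [gd _] z; rewrite derive1E; apply/derivableP; exact: (gd 0%N).
Qed.

Theorem theorem1p2 (R : realType) (eps : R) (heps : 0 < eps < 1)
    (f : circle R -> circle R) (hf : map_class 2 eps f) (hexp : expanding f)
    (v : circle R -> R) (hv : fun_class 1 eps v) :
  fun_class 1 eps (weierstrass f v) \/
  nowhere_differentiable (weierstrass f v).
Proof.
have [eps0 _] := andP heps.
have [F [lF hF]] := hf; have [lam lam1 hlam] := hexp.
have Fd := holder_class_is_derive hF; have hF1 := holder_class_derivative hF.
have F1d := holder_class_is_derive hF1.
have [_ [CF F2_holder]] := hF1; rewrite derive1n1 in F2_holder.
have cF := is_derive_continuous Fd.
have F1_ge z : lam <= `|derive1 F z|.
  by rewrite -(Dcircle_lift cF lF) ltW.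
have [c Fc] := lift_add1 cF lF.
have F1p t : derive1 F (t + 1) = derive1 F t + 0.
  by rewrite addr0; exact: derive1_shift1 Fc t.
have F2p := derive1_shift1 F1p.
have [C F2_le] := periodic_bounded (ltW eps0) F2p F2_holder.
pose V := v \o @Defs.proj R.
have Vp t : V (t + 1) = V t + 0 by rewrite addr0 /V /= proj_add1.
have Vd := holder_class_is_derive hv; rewrite -/V in Vd.
have [_ [CV V1_holder]] := hv; rewrite derive1n1 -/V in V1_holder.
have [MV V1_le] := periodic_bounded (ltW eps0) (derive1_shift1 Vp) V1_holder.
have [M0 V_le] : exists M0 : R, forall t, `|V t| <= M0.
  apply: (@periodic_bounded _ V MV 1) => // [t|s t]; first by rewrite Vp addr0.
  by rewrite powRr1//; exact: is_derive_lipschitz Vd V1_le s t.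
pose A := weierstrass f v \o @Defs.proj R.
have AE t : A t = - cocycle_sum F (derive1 F) V t by exact: weierstrass_proj.
have [M AM] := cocycle_sum_bounded F lam1 F1_ge V_le.
have [[x dx]|nd] := pselect (exists x,
    differentiable_on_circle_at (weierstrass f v) x); last first.
  by right=> x dx; apply: nd; exists x.
left; rewrite /fun_class -/A; have dA := derivableP (dx : derivable A (rep x) 1).
have [G [FK GK]] := expanding_inverse lam1 Fd F1d F1_ge.
apply: (holder_class1_of_differentiable_at heps lam1 Fd F1d
  F1_ge F2_le F2_holder Vd V1_le V1_holder (M := M) _ _ dA FK GK).
- by move=> s; rewrite AE normrN.
- by move=> t; rewrite !AE mulrN (cocycle_sumE F lam1 F1_ge V_le) opprD addrA subrr sub0r.
- by move=> t; rewrite /A /= proj_add1.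
Qed.
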